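(* Consider a separable $s$-stage FRKN method with distinct real parameters $c_1,\dots,c_s$, characterized by the set of basis functions $\boldsymbol{u}(t)=(1,t,u_1(t),\dots,u_s(t))^T=e^{\boldsymbol{S}t}\boldsymbol{u}_0$ with $\boldsymbol{S}\in\mathbb{R}^{(s+2)\times(s+2)}$ a constant matrix and $\boldsymbol{u}_0=\boldsymbol{u}(0)$, and with coefficients $\boldsymbol{A}(h),\boldsymbol{b}(h),\boldsymbol{d}(h)$. Let $\lambda\in\mathbb{R}$, let $h>0$ be such that the coefficients exist, and let $z=\lambda h^2$. Then, whenever the inverses involved exist, the stability matrix of the method is $$M(z,h)=\begin{pmatrix}1+z\boldsymbol{b}^T(h)[I-z\boldsymbol{A}(h)]^{-1}\boldsymbol{e}&1+z\boldsymbol{b}^T(h)[I-z\boldsymbol{A}(h)]^{-1}\boldsymbol{c}\\ z\boldsymbol{d}^T(h)[I-z\boldsymbol{A}(h)]^{-1}\boldsymbol{e}&1+z\boldsymbol{d}^T(h)[I-z\boldsymbol{A}(h)]^{-1}\boldsymbol{c}\end{pmatrix}=\begin{pmatrix}\boldsymbol{e}_1^T\boldsymbol{W}^{-1}e^{\boldsymbol{S}h}\boldsymbol{u}_0&h^{-1}\boldsymbol{e}_2^T\boldsymbol{W}^{-1}e^{\boldsymbol{S}h}\boldsymbol{u}_0\\ h\boldsymbol{e}_1^T\boldsymbol{W}^{-1}\boldsymbol{S}e^{\boldsymbol{S}h}\boldsymbol{u}_0&\boldsymbol{e}_2^T\boldsymbol{W}^{-1}\boldsymbol{S}e^{\boldsymbol{S}h}\boldsymbol{u}_0\end{pmatrix},$$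 where $\boldsymbol{e}_1$ and $\boldsymbol{e}_2$ denote the first and second columns of the identity matrix of dimension $s+2$, and $\boldsymbol{W}$ is the $(s+2)\times(s+2)$ matrix with columns $$\boldsymbol{W}=\begin{bmatrix}\boldsymbol{u}_0&\boldsymbol{S}\boldsymbol{u}_0&[(h\boldsymbol{S})^2-zI]e^{\boldsymbol{S}c_1h}\boldsymbol{u}_0&\cdots&[(h\boldsymbol{S})^2-zI]e^{\boldsymbol{S}c_sh}\boldsymbol{u}_0\end{bmatrix}.$$
   Context: Notation: $\boldsymbol{c}=(c_1,\dots,c_s)^T$, $\boldsymbol{e}=(1,\dots,1)^T\in\mathbb{R}^s$; scalar functions are applied componentwise to vectors; $I$ is the identity matrix of the appropriate dimension. Separable basis: a set of functions $\{u_k\}_{k=1}^s$ on $\mathbb{R}$ such that $1,t,u_1(t),\dots,u_s(t)$ are linearly independent and $\boldsymbol{u}(t)=(1,t,u_1(t),\dots,u_s(t))^T$ satisfies $\boldsymbol{u}(t+h)=\boldsymbol{\mathcal{F}}(h)\boldsymbol{u}(t)=\boldsymbol{\mathcal{F}}(t)\boldsymbol{u}(h)$ for all $t,h\in\mathbb{R}$ for some matrix function $\boldsymbol{\mathcal{F}}:\mathbb{R}\to\mathbb{R}^{(s+2)\times(s+2)}$; it is known that then $\boldsymbol{\mathcal{F}}(t)=e^{\boldsymbol{S}t}$ with $\boldsymbol{S}=\boldsymbol{\mathcal{F}}'(0)$, so $\boldsymbol{u}(t)=e^{\boldsymbol{S}t}\boldsymbol{u}_0$. An FRKN method whose basis is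 separable is called separable. FRKN coefficients: $\boldsymbol{A}(t,h)\in\mathbb{R}^{s\times s}$, $\boldsymbol{b}(t,h),\boldsymbol{d}(t,h)\in\mathbb{R}^s$ are determined by the relations, for all $k=1,\dots,s$, $$u_k(t+h)=u_k(t)+hu_k'(t)+h^2\boldsymbol{b}(t,h)^Tu_k''(\boldsymbol{e}t+\boldsymbol{c}h),$$ $$u_k'(t+h)=u_k'(t)+h\,\boldsymbol{d}(t,h)^Tu_k''(\boldsymbol{e}t+\boldsymbol{c}h),$$ $$u_k(\boldsymbol{e}t+\boldsymbol{c}h)=\boldsymbol{e}u_k(t)+h\boldsymbol{c}u_k'(t)+h^2\boldsymbol{A}(t,h)u_k''(\boldsymbol{e}t+\boldsymbol{c}h).$$ For a separable basis the coefficients exist for almost every $h$ and do not depend on $t$, and one writes $\boldsymbol{A}(h)=\boldsymbol{A}(0,h)$, $\boldsymbol{b}(h)=\boldsymbol{b}(0,h)$, $\boldsymbol{d}(h)=\boldsymbol{d}(0,h)$. The coefficients are taken at values of $h$ for which the collocation condition holds, i.e. the $s\times s$ matrices with $(i,k)$ entries $u_k(t+c_ih)-u_k(t)-c_ihu_k'(t)$ and $u_k''(t+c_ih)$ are nonsingular. Method and stability matrix: one step of the method for $y''=f(t,y)$ is $$\boldsymbol{Y}_n=\boldsymbol{e}y_n+\boldsymbol{c}hy_n'+h^2\boldsymbol{A}(h)f(\boldsymbol{e}t_n+\boldsymbol{c}h,\boldsymbol{Y}_n),$$ $$y_{n+1}=y_n+hy_n'+h^2\boldsymbol{b}(h)^Tf(\boldsymbol{e}t_n+\boldsymbol{c}h,\boldsymbol{Y}_n),\qquad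 y_{n+1}'=y_n'+h\,\boldsymbol{d}(h)^Tf(\boldsymbol{e}t_n+\boldsymbol{c}h,\boldsymbol{Y}_n),$$ with $f(\boldsymbol{e}t_n+\boldsymbol{c}h,\boldsymbol{Y}_n)=(f(t_n+c_1h,Y_{n,1}),\dots,f(t_n+c_sh,Y_{n,s}))^T$. Applied to the test problem $y''=\lambda y$, $y(0)=y_0$, $y'(0)=y_0'$, it takes the form $$\begin{pmatrix} y_{n+1} \\ h y_{n+1}' \end{pmatrix}=M(z,h)\begin{pmatrix} y_n \\ h y_n' \end{pmatrix},\qquad z=\lambda h^2,$$ and the $2\times2$ matrix $M(z,h)$ is called the stability matrix of the method. *)

(* Defs.v *)
From HB Require Import structures.
From mathcomp Require Import all_boot all_order all_algebra.
From mathcomp Require Import all_classical all_reals all_analysis.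
Import Order.TTheory GRing.Theory Num.Theory.
Import numFieldNormedType.Exports.

Set Implicit Arguments.
Unset Strict Implicit.
Unset Printing Implicit Defensive.

Local Open Scope classical_set_scope.
Local Open Scope ring_scope.

Definition expmx (R : realType) (n : nat) (A : 'M[R]_n.+1) : 'M[R]_n.+1 :=
  limn (series (fun k : nat => (k`!%:R)^-1 *: A ^+ k)).

Definition evec (R : realType) (s : nat) : 'cV[R]_s := const_mx 1.

Section Basis.
Variables (R : realType) (s : nat).

(* u(t) = (1, t, u_1(t), ..., u_s(t))^T *)
Definition basis_vec (u : 'I_s -> R -> R) (t : R) : 'cV[R]_s.+2 :=
  col_mx (1%:M : 'M[R]_1) (col_mx (t%:M : 'M[R]_1) (\col_(k < s) u k t)).

Definition separable_basis (u : 'I_s -> R -> R) : Prop :=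
  (forall a : 'rV[R]_s.+2, (forall t : R, a *m basis_vec u t = 0) -> a = 0) /\
  (exists F : R -> 'M[R]_s.+2, forall t h : R,
     basis_vec u (t + h) = F h *m basis_vec u t /\
     basis_vec u (t + h) = F t *m basis_vec u h).

Definition collocation_cond (u : 'I_s -> R -> R) (c : 'cV[R]_s) (t h : R)
    : Prop :=
  (\matrix_(i < s, k < s)
     (u k (t + c i 0 * h) - u k t - c i 0 * h * derive1 (u k) t)) \in unitmx /\
  (\matrix_(i < s, k < s) derive1n 2 (u k) (t + c i 0 * h)) \in unitmx.

Definition FRKN_relations (u : 'I_s -> R -> R) (c : 'cV[R]_s) (t h : R)
    (A : 'M[R]_s) (b d : 'cV[R]_s) : Prop :=
  let nodes := t *: evec R s + h *: c in
  forall k : 'I_s,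
    [/\ u k (t + h) = u k t + h * derive1 (u k) t
          + h ^+ 2 * (b^T *m map_mx (derive1n 2 (u k)) nodes) 0 0,
        derive1 (u k) (t + h) = derive1 (u k) t
          + h * (d^T *m map_mx (derive1n 2 (u k)) nodes) 0 0
      & map_mx (u k) nodes = u k t *: evec R s + (h * derive1 (u k) t) *: c
          + h ^+ 2 *: (A *m map_mx (derive1n 2 (u k)) nodes)].

(* No constraint is put on the values at points (t, h) that violate the
   collocation condition, where the coefficients need not exist. *)
Definition FRKN_coefficients (u : 'I_s -> R -> R) (c : 'cV[R]_s)
    (A : R -> R -> 'M[R]_s) (b d : R -> R -> 'cV[R]_s) : Prop :=
  forall t h : R, collocation_cond u c t h ->
    FRKN_relations u c t h (A t h) (b t h) (d t h).

End Basis.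

Section Method.
Variables (R : realType) (s : nat).

(* (Y, y1, y1') is a result of one step of size h for y'' = f(t, y) from
   (y, y') at time t; the internal stages Y are given implicitly. *)
Definition FRKN_step (c : 'cV[R]_s) (A : 'M[R]_s) (b d : 'cV[R]_s) (h : R)
    (f : R -> R -> R) (t y y' : R) (Y : 'cV[R]_s) (y1 y1' : R) : Prop :=
  let fY := \col_(i < s) f (t + c i 0 * h) (Y i 0) in
  [/\ Y = y *: evec R s + (h * y') *: c + h ^+ 2 *: (A *m fY),
      y1 = y + h * y' + h ^+ 2 * (b^T *m fY) 0 0
    & y1' = y' + h * (d^T *m fY) 0 0].

Definition state_vec (h y y' : R) : 'cV[R]_2 :=
  col_mx (y%:M : 'M[R]_1) ((h * y')%:M : 'M[R]_1).

Definition is_stability_matrix (c : 'cV[R]_s) (A : 'M[R]_s) (b d : 'cV[R]_s)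
    (lambda h : R) (M : 'M[R]_2) : Prop :=
  forall (t y y' : R) (Y : 'cV[R]_s) (y1 y1' : R),
    FRKN_step c A b d h (fun _ x => lambda * x) t y y' Y y1 y1' ->
    state_vec h y1 y1' = M *m state_vec h y y'.

Definition stability_matrix_coeffs (c : 'cV[R]_s) (A : 'M[R]_s)
    (b d : 'cV[R]_s) (z : R) : 'M[R]_2 :=
  let K := invmx (1%:M - z *: A) in
  block_mx
    (1%:M + z *: (b^T *m K *m evec R s) : 'M[R]_1)
    (1%:M + z *: (b^T *m K *m c) : 'M[R]_1)
    (z *: (d^T *m K *m evec R s) : 'M[R]_1)
    (1%:M + z *: (d^T *m K *m c) : 'M[R]_1).

Definition Wmx (S : 'M[R]_s.+2) (u0 : 'cV[R]_s.+2) (c : 'cV[R]_s) (z h : R)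
    : 'M[R]_s.+2 :=
  row_mx u0 (row_mx (S *m u0)
    (\matrix_(i < s.+2, j < s)
       (((h *: S) ^+ 2 - z%:M) *m expmx ((c j 0 * h) *: S) *m u0) i 0)).

Definition stability_matrix_exp (S : 'M[R]_s.+2) (u0 : 'cV[R]_s.+2)
    (c : 'cV[R]_s) (z h : R) : 'M[R]_2 :=
  let Winv := invmx (Wmx S u0 c z h) in
  let e1 : 'cV[R]_s.+2 := col 0 1%:M in
  let e2 : 'cV[R]_s.+2 := col 1 1%:M in
  block_mx
    (e1^T *m Winv *m expmx (h *: S) *m u0 : 'M[R]_1)
    (h^-1 *: (e2^T *m Winv *m expmx (h *: S) *m u0) : 'M[R]_1)
    (h *: (e1^T *m Winv *m S *m expmx (h *: S) *m u0) : 'M[R]_1)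
    (e2^T *m Winv *m S *m expmx (h *: S) *m u0 : 'M[R]_1).

End Method.

(* Main.v *)
Require Import Defs.
From HB Require Import structures.
From mathcomp Require Import all_boot all_order all_algebra.
From mathcomp Require Import all_classical all_reals all_analysis.
From mathcomp Require Import ring.
Import Order.TTheory GRing.Theory Num.Theory.
Import numFieldNormedType.Exports.
Local Open Scope classical_set_scope.
Local Open Scope ring_scope.

(** The method reproduces the flow U(t) = e^(St) u_0 exactly, and the columns
    of W are arranged so that this exactness can be solved for the entries of
    the stability matrix.

    Differentiating the exponential series term by term shows U' = S U, hence
    U'' = S^2 U, entrywise.  The relations that determine the coefficients are
    linear in the function they are applied to.  They hold for u_1, ..., u_s by
    definition, and for the entries 1 and t of U because the second derivative
    of an affine function vanishes.  So they hold for the whole vector U: with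
    N and V the matrices with columns U''(c_j h) and U(c_j h),

      U(h)   = u_0 + h S u_0 + h^2 N b,
      S U(h) = S u_0 + h N d,
      V      = u_0 e^T + h (S u_0) c^T + h^2 N A^T.

    The last columns of W form X = h^2 N - z V.  Substituting the formula for V
    into h^2 N = X + z V gives

      h^2 N (I - z A)^T = X + z u_0 e^T + z h (S u_0) c^T,

    and therefore, with K = (I - z A)^-1 and for every weight vector w,

      h^2 N w = W (z w^T K e, h z w^T K c, K^T w)^T

    ([stage_elimination]).  Taking w = b and w = d in the formulas for U(h) and
    S U(h) expresses both of them as W applied to explicit vectors; the first
    two coordinates of W^-1 U(h) and W^-1 S U(h) are then, up to powers of h,
    the entries of the matrix written with the coefficients
    ([stability_matrix_coeffs_exp]).

    That this matrix is the stability matrix, and the only one, follows by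
    solving the stage equations of the test problem, which always have the
    solution Y = K (y e + h y' c), and from the fact that every vector is a
    state vector, as h is nonzero ([unique_stability_matrix]). *)

(** * Differentiating the matrix exponential *)

Lemma mx_norm_entry_le {R : realType} {m n} (X : 'M[R]_(m, n)) i j :
  `|X i j| <= `|X|.
Proof.
rewrite [leRHS]/Num.norm /= mx_normrE.
exact: (le_bigmax _ (fun ij => `|X ij.1 ij.2|) (i, j)).
Qed.

Lemma mx_norm_le {R : realType} {m n} (X : 'M[R]_(m, n)) (C : R) :
  0 <= C -> (forall i j, `|X i j| <= C) -> `|X| <= C.
Proof.
move=> C0 XC; rewrite [leLHS]/Num.norm /= mx_normrE.
by apply: bigmax_le => // -[i j] _; exact: XC.
Qed.

(** The norm is the maximum of the entries, which is not submultiplicative: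
    the factor n.+1 counts the terms of an entry of a product. *)
Lemma mx_norm_exp_le {R : realType} {n} (X : 'M[R]_n.+1) k :
  `|X ^+ k| <= (n.+1%:R * `|X|) ^+ k.
Proof.
elim: k => [|k IHk].
  apply: mx_norm_le => // i j; rewrite !expr0 !mxE normr_nat.
  by case: (i == j).
have XC0 : 0 <= n.+1%:R * `|X| by rewrite mulr_ge0.
apply: mx_norm_le => [|i j]; first exact: exprn_ge0.
rewrite exprS mxE (le_trans (ler_norm_sum _ _ _))//.
have -> : (n.+1%:R * `|X|) ^+ k.+1 =
    \sum_(l < n.+1) `|X| * (n.+1%:R * `|X|) ^+ k.
  by rewrite sumr_const card_ord -[RHS]mulr_natl exprS mulrA.
apply: ler_sum => l _; rewrite normrM ler_pM ?mx_norm_entry_le//.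
exact: le_trans (mx_norm_entry_le _ _ _) IHk.
Qed.

(** That absolute convergence implies convergence is a property of complete
    normed modules, so the two structures of matrices have to be joined. *)
HB.instance Definition _ (R : realType) (m n : nat) := Complete.on 'M[R]_(m, n).

Lemma is_cvg_series_expmx {R : realType} {n} (X : 'M[R]_n.+1) :
  cvgn (series (fun k : nat => (k`!%:R)^-1 *: X ^+ k)).
Proof.
apply: normed_cvg.
apply: (@series_le_cvg _ _ (exp_coeff (n.+1%:R * `|X|))) => [k|k|k|].
- exact: normr_ge0.
- by rewrite /exp_coeff /= divr_ge0// exprn_ge0// mulr_ge0.
- rewrite /= normrZ ger0_norm ?invr_ge0// /exp_coeff /= mulrC.
  by rewrite ler_pM2r ?invr_gt0 ?ltr0n ?fact_gt0// mx_norm_exp_le.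
- exact: is_cvg_series_exp_coeff.
Qed.

Lemma continuous_mx_sandwich {R : realType} {m n}
    (r : 'rV[R]_m) (v : 'cV[R]_n) :
  continuous (fun X : 'M[R]_(m, n) => (r *m X *m v) 0 0).
Proof.
have -> : (fun X : 'M[R]_(m, n) => (r *m X *m v) 0 0) =
    (fun X : 'M[R]_(m, n) => \sum_j (\sum_i r 0 i * X i j) * v j 0).
  by apply/funext => Y; rewrite mxE; apply: eq_bigr => j _; rewrite mxE.
apply: continuous_big => [|j _]; first by move=> p; exact: add_continuous.
move=> Y; apply: continuousM; last exact: cst_continuous.
apply: continuous_big => [|i _]; first by move=> p; exact: add_continuous.
move=> Z; apply: continuousM; [exact: cst_continuous|exact: coord_continuous].
Qed.

(** Coefficients of the scalar power series t |-> r e^(tS) v.  Keeping both the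
    row r and the column v free makes the family closed under differentiation,
    with r replaced by r S, so that the derivative has S on the left of the
    exponential. *)
Definition expmx_coeff {R : realType} {n} (S : 'M[R]_n.+1)
    (r : 'rV[R]_n.+1) (v : 'cV[R]_n.+1) : R^nat :=
  fun k => (k`!%:R)^-1 * (r *m S ^+ k *m v) 0 0.

Lemma cvg_pseries_expmx {R : realType} {n} (S : 'M[R]_n.+1)
    (r : 'rV[R]_n.+1) (v : 'cV[R]_n.+1) (t : R) :
  pseries (expmx_coeff S r v) t @ \oo --> (r *m expmx (t *: S) *m v) 0 0.
Proof.
have -> : pseries (expmx_coeff S r v) t =
    (fun X : 'M[R]_n.+1 => (r *m X *m v) 0 0) \o
    series (fun k : nat => (k`!%:R)^-1 *: (t *: S) ^+ k).
  apply/funext => N /=.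
  rewrite /pseries /series /= mulmx_sumr mulmx_suml summxE.
  apply: eq_bigr => k _; rewrite exprZn -!(scalemxAr, scalemxAl) mxE.
  rewrite [X in _ = _ * X]mxE.
  by rewrite /expmx_coeff -mulrA [_ * t ^+ k]mulrC.
apply: continuous_cvg; first exact: continuous_mx_sandwich.
exact: is_cvg_series_expmx.
Qed.

Lemma expmx_coeff_diffs {R : realType} {n} (S : 'M[R]_n.+1)
    (r : 'rV[R]_n.+1) (v : 'cV[R]_n.+1) :
  pseries_diffs (expmx_coeff S r v) = expmx_coeff S (r *m S) v.
Proof.
apply/funext => k; rewrite /pseries_diffs /expmx_coeff.
rewrite factS natrM invfM mulrA mulVKf// exprS.
by rewrite -[S * _]/(S *m _) mulmxA.
Qed.

Lemma is_derive_expmx {R : realType} {n} (S : 'M[R]_n.+1)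
    (r : 'rV[R]_n.+1) (v : 'cV[R]_n.+1) (t : R) :
  is_derive t (1 : R) (fun x => (r *m expmx (x *: S) *m v) 0 0)
    ((r *m S *m expmx (t *: S) *m v) 0 0).
Proof.
have expE (q : 'rV[R]_n.+1) x :
    (q *m expmx (x *: S) *m v) 0 0 = limn (pseries (expmx_coeff S q v) x).
  by apply/esym/cvg_lim => //; exact: cvg_pseries_expmx.
under eq_fun do rewrite expE.
rewrite expE -expmx_coeff_diffs.
(* The series converges everywhere, so any radius beyond t serves. *)
apply: (@pseries_snd_diffs _ _ (`|t| + 1)); rewrite ?expmx_coeff_diffs;
  try by apply: cvgP; exact: cvg_pseries_expmx.
by rewrite [ltRHS]ger0_norm ?ltrDl// addr_ge0.
Qed.

Lemma derive1_expmx {R : realType} {n} (S : 'M[R]_n.+1)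
    (r : 'rV[R]_n.+1) (v : 'cV[R]_n.+1) :
  derive1 (fun x => (r *m expmx (x *: S) *m v) 0 0) =
  (fun x => (r *m S *m expmx (x *: S) *m v) 0 0).
Proof.
apply/funext => t; rewrite derive1E.
by have [_ ->] := is_derive_expmx S r v t.
Qed.

(** An entry of the flow is r e^(tS) v for a unit row r, and each derivative
    multiplies r by S on the right. *)
Lemma derive_expmx_flow {R : realType} {n} {S : 'M[R]_n.+1} {v : 'cV[R]_n.+1}
    {g : R -> 'cV[R]_n.+1} (gE : forall t, g t = expmx (t *: S) *m v)
    (i : 'I_n.+1) :
  derive1 (fun t => g t i 0) = (fun t => (S *m g t) i 0) /\
  derive1n 2 (fun t => g t i 0) = (fun t => (S *m S *m g t) i 0).
Proof.
have rowE0 (X : 'cV[R]_n.+1) : X i 0 = ((delta_mx 0 i : 'rV_n.+1) *m X) 0 0.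
  by rewrite -rowE mxE.
have -> : (fun t => g t i 0) =
    (fun t => ((delta_mx 0 i : 'rV_n.+1) *m expmx (t *: S) *m v) 0 0).
  by apply/funext => t; rewrite gE rowE0 mulmxA.
rewrite /= /derive1n /= !derive1_expmx; split; apply/funext => t;
  by rewrite gE rowE0 !mulmxA.
Qed.

(** * Exactness on the whole basis *)

(** The relations that define the coefficients, for a single function, so that
    they can be applied to 1 and t as well as to the u_k. *)
Definition FRKN_exact {R : realType} {s} (c : 'cV[R]_s) (t h : R)
    (A : 'M[R]_s) (b d : 'cV[R]_s) (g : R -> R) : Prop :=
  let nodes := t *: evec R s + h *: c in
  [/\ g (t + h) = g t + h * derive1 g t
        + h ^+ 2 * (b^T *m map_mx (derive1n 2 g) nodes) 0 0,
      derive1 g (t + h) = derive1 g t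
        + h * (d^T *m map_mx (derive1n 2 g) nodes) 0 0
    & map_mx g nodes = g t *: evec R s + (h * derive1 g t) *: c
        + h ^+ 2 *: (A *m map_mx (derive1n 2 g) nodes)].

(** The second derivative is zero, so the coefficients drop out and the
    relations are the first-order Taylor expansion. *)
Lemma FRKN_exact_affine {R : realType} {s} (c : 'cV[R]_s) (t h : R)
    (A : 'M[R]_s) (b d : 'cV[R]_s) (p q : R) :
  FRKN_exact c t h A b d (fun x => p + q * x).
Proof.
have d1 : derive1 (fun x : R => p + q * x) = cst q.
  apply/funext => x; rewrite derive1E.
  have [_ ->//] : is_derive x 1 (fun x : R => p + q * x) q.
  by apply: is_derive_eq; rewrite add0r mul1r; exact: mulr1.
have d2 : derive1n 2 (fun x : R => p + q * x) = cst 0.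
  by rewrite /derive1n /= d1; apply/funext => x; rewrite derive1_cst.
rewrite /FRKN_exact d1 d2.
have -> m : map_mx (cst 0) m = 0 :> 'cV[R]_s.
  by apply/colP => i; rewrite !mxE.
rewrite !mulmx0 !scaler0 !mxE !mulr0 !addr0; split => //=; first by ring.
by apply/colP => i; rewrite !mxE; ring.
Qed.

Lemma FRKN_exact_basis {R : realType} {s} {u : 'I_s -> R -> R}
    {c : 'cV[R]_s} {t h : R} {A : 'M[R]_s} {b d : 'cV[R]_s} :
  FRKN_relations u c t h A b d ->
  forall i, FRKN_exact c t h A b d (fun x => basis_vec u x i 0).
Proof.
move=> rel i; rewrite -[i](@splitK 1 s.+1).
case: (fintype.split _) => {i} [j|i] /=.
  rewrite (_ : (fun x => _) = (fun x => 1 + 0 * x)).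
    exact: FRKN_exact_affine.
  apply/funext => x; rewrite /basis_vec [LHS](@col_mxEu _ 1 s.+1).
  by rewrite ord1 mxE mul0r addr0.
rewrite -[i](@splitK 1 s); case: (fintype.split _) => {i} [j|k] /=.
  rewrite (_ : (fun x => _) = (fun x => 0 + 1 * x)).
    exact: FRKN_exact_affine.
  apply/funext => x; rewrite /basis_vec [LHS](@col_mxEd _ 1 s.+1).
  by rewrite [LHS](@col_mxEu _ 1 s) ord1 mxE mul1r add0r.
rewrite (_ : (fun x => _) = u k); first exact: rel.
apply/funext => x; rewrite /basis_vec [LHS](@col_mxEd _ 1 s.+1).
by rewrite [LHS](@col_mxEd _ 1 s) mxE.
Qed.

(** The relations hold for all entries of the basis vector, hence for the vector
    itself, whose derivatives are given by S. *)
Lemma separable_step_relations {R : realType} {s} {u : 'I_s -> R -> R}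
    {S : 'M[R]_s.+2} {c : 'cV[R]_s} {A : 'M[R]_s} {b d : 'cV[R]_s} {h : R} :
  (forall t, basis_vec u t = expmx (t *: S) *m basis_vec u 0) ->
  FRKN_relations u c 0 h A b d ->
  let U := basis_vec u in
  let V := \matrix_(i, j) U (c j 0 * h) i 0 in
  let N := \matrix_(i, j) (S *m S *m U (c j 0 * h)) i 0 in
  [/\ U h = U 0 + h *: (S *m U 0) + h ^+ 2 *: (N *m b),
      S *m U h = S *m U 0 + h *: (N *m d)
    & V = U 0 *m (evec R s)^T + h *: (S *m U 0 *m c^T) + h ^+ 2 *: (N *m A^T)].
Proof.
move=> flow rel U V N.
have nodeE j : (0 *: evec R s + h *: c) j 0 = c j 0 * h.
  by rewrite !mxE mul0r add0r mulrC.
have quadE i (w : 'cV[R]_s) :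
    (w^T *m map_mx (fun t => (S *m S *m U t) i 0) (0 *: evec R s + h *: c)) 0 0
    = (N *m w) i 0.
  rewrite [LHS]mxE [RHS]mxE; apply: eq_bigr => j _.
  by rewrite mulrC [w^T _ _]mxE [map_mx _ _ _ _]mxE nodeE [N i j]mxE.
split; apply/matrixP => i j.
- have [+ _ _] := FRKN_exact_basis rel i.
  have [-> ->] := derive_expmx_flow flow i.
  by rewrite add0r quadE !ord1 => ->; rewrite !mxE.
- have [_ + _] := FRKN_exact_basis rel i.
  have [-> ->] := derive_expmx_flow flow i.
  by rewrite add0r quadE !ord1 => ->; rewrite [RHS]mxE; congr (_ + _);
    rewrite [RHS]mxE.
- have [_ _] := FRKN_exact_basis rel i.
  have [-> ->] := derive_expmx_flow flow i.
  move=> /colP/(_ j); rewrite [LHS]mxE nodeE [V i j]mxE => ->.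
  have outerE (p : 'cV[R]_s.+2) (q : 'cV[R]_s) : (p *m q^T) i j = p i 0 * q j 0.
    by rewrite mxE big_ord1 [q^T _ _]mxE.
  have internalE : (N *m A^T) i j = (A *m map_mx (fun t => (S *m S *m U t) i 0)
      (0 *: evec R s + h *: c)) j 0.
    rewrite [LHS]mxE [RHS]mxE; apply: eq_bigr => l _.
    by rewrite mulrC [A^T _ _]mxE [map_mx _ _ _ _]mxE nodeE [N i l]mxE.
  rewrite [LHS]mxE [RHS]mxE; congr (_ + _).
    rewrite [LHS]mxE [RHS]mxE outerE; congr (_ + _); first by rewrite [LHS]mxE.
    by rewrite [LHS]mxE [RHS]mxE outerE mulrA.
  by rewrite [LHS]mxE [RHS]mxE internalE.
Qed.

(** * Eliminating the stages *)

(** Substituting the formula for V in the block X = h^2 N - z V gives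
    X + z p e^T + h z q c^T = h^2 N (I - z A)^T, and the last factor can be
    inverted.  The columns of N and V stand for the second derivatives and the
    values at the nodes. *)
Lemma stage_elimination {R : comUnitRingType} {m s} {p q : 'cV[R]_m}
    {V N : 'M[R]_(m, s)} {A : 'M[R]_s} {e c : 'cV[R]_s} {h z : R} :
  V = p *m e^T + h *: (q *m c^T) + h ^+ 2 *: (N *m A^T) ->
  1%:M - z *: A \in unitmx ->
  forall w : 'cV[R]_s,
  let K := invmx (1%:M - z *: A) in
  h ^+ 2 *: (N *m w) =
  row_mx p (row_mx q (h ^+ 2 *: N - z *: V)) *m
    col_mx (z *: (w^T *m K *m e))
      (col_mx ((h * z) *: (w^T *m K *m c)) (K^T *m w)).
Proof.
move=> VE Aunit w K.
have NE : h ^+ 2 *: N = (h ^+ 2 *: N - z *: V + z *: (p *m e^T)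
    + (h * z) *: (q *m c^T)) *m K^T.
  have -> : h ^+ 2 *: N - z *: V + z *: (p *m e^T) + (h * z) *: (q *m c^T) =
      h ^+ 2 *: (N *m (1%:M - z *: A)^T).
    have -> : (1%:M - z *: A)^T = 1%:M - z *: A^T.
      by apply/matrixP => i j; rewrite !mxE eq_sym.
    rewrite VE mulmxBr mulmx1 -scalemxAr.
    move: (N *m A^T) (p *m e^T) (q *m c^T) => NA pe qc.
    by apply/matrixP => i j; rewrite !mxE; ring.
  by rewrite -scalemxAl -mulmxA -trmx_mul mulVmx// trmx1 mulmx1.
have trE (x : 'cV[R]_s) : x^T *m (K^T *m w) = w^T *m K *m x.
  have sym (X : 'M[R]_1) : X^T = X by apply/matrixP => i j; rewrite mxE !ord1.
  by rewrite -[RHS]sym !trmx_mul trmxK mulmxA.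
rewrite scalemxAl [in LHS]NE -mulmxA 2!mulmxDl -!scalemxAl -!mulmxA.
rewrite !(trE, mul_row_col) -!scalemxAr !mulmxA addrC addrA.
by rewrite addrC addrA.
Qed.

(** Brings W into the form required by [stage_elimination], with blocks p, q
    and h^2 N - z V. *)
Lemma Wmx_columns {R : realType} {s} {S : 'M[R]_s.+2} (c : 'cV[R]_s)
    {U : R -> 'cV[R]_s.+2} (z h : R) :
  (forall t, U t = expmx (t *: S) *m U 0) ->
  Wmx S (U 0) c z h = row_mx (U 0) (row_mx (S *m U 0)
    (h ^+ 2 *: (\matrix_(i, j) (S *m S *m U (c j 0 * h)) i 0)
      - z *: (\matrix_(i, j) U (c j 0 * h) i 0))).
Proof.
move=> flow; rewrite /Wmx; apply: (f_equal (@row_mx _ s.+2 1 s.+1 _)).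
apply: (f_equal (@row_mx _ s.+2 1 s _)).
apply/matrixP => i j; rewrite mxE -mulmxA -flow mulmxBl exprZn [S ^+ 2]expr2.
rewrite -scalemxAl mul_scalar_mx -[S * S]/(S *m S).
by rewrite !mxE.
Qed.

(** Every vector involved is W applied to an explicit vector, and e_1, e_2 read
    off its first two coordinates. *)
Lemma stability_matrix_coeffs_exp {R : realType} {s} (u : 'I_s -> R -> R)
    (S : 'M[R]_s.+2) (c : 'cV[R]_s) (A : 'M[R]_s) (b d : 'cV[R]_s) (z h : R) :
  h != 0 ->
  (forall t, basis_vec u t = expmx (t *: S) *m basis_vec u 0) ->
  FRKN_relations u c 0 h A b d ->
  1%:M - z *: A \in unitmx ->
  Wmx S (basis_vec u 0) c z h \in unitmx ->
  stability_matrix_coeffs c A b d z =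
    stability_matrix_exp S (basis_vec u 0) c z h.
Proof.
move=> h0 flow rel Aunit Wunit.
have [Uh SUh VE] := separable_step_relations flow rel.
have elim := stage_elimination VE Aunit.
rewrite -(Wmx_columns c z h flow) in elim.
rewrite /stability_matrix_exp -!mulmxA -flow.
set W := Wmx _ _ _ _ _ in Wunit elim *.
set K := invmx (1%:M - z *: A) in elim *.
have U0E : basis_vec u 0 = W *m col_mx 1%:M (0%R : 'cV[R]_s.+1).
  rewrite /W (Wmx_columns _ _ _ flow) [RHS](@mul_row_col _ _ 1 s.+1).
  by rewrite mulmx1 mulmx0 addr0.
have SU0E : S *m basis_vec u 0 =
    W *m col_mx (0%R : 'M[R]_1) (col_mx 1%:M (0%R : 'cV[R]_s)).
  rewrite /W (Wmx_columns _ _ _ flow) [RHS](@mul_row_col _ _ 1 s.+1).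
  rewrite mulmx0 add0r.
  by rewrite [RHS](@mul_row_col _ _ 1 s) mulmx1 mulmx0 addr0.
have coord_row (i : 'I_s.+2) (X : 'cV[R]_s.+2) :
    (col i 1%:M : 'cV[R]_s.+2)^T *m X = row i X.
  by rewrite tr_col trmx1 row1 -rowE.
have fst_coord (x y : 'M[R]_1) (w : 'cV[R]_s) :
    (col 0 1%:M : 'cV[R]_s.+2)^T *m (col_mx x (col_mx y w)) = x.
  rewrite coord_row (_ : 0 = lshift s.+1 0 :> 'I_(1 + s.+1));
    last exact: val_inj.
  by rewrite [LHS](@rowKu _ 1 s.+1); apply/rowP => k; rewrite mxE !ord1.
have snd_coord (x y : 'M[R]_1) (w : 'cV[R]_s) :
    (col 1 1%:M : 'cV[R]_s.+2)^T *m (col_mx x (col_mx y w)) = y.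
  rewrite coord_row (_ : 1 = rshift 1 (lshift s 0) :> 'I_(1 + (1 + s)));
    last exact: val_inj.
  rewrite [LHS](@rowKd _ 1 s.+1) [LHS](@rowKu _ 1 s).
  by apply/rowP => k; rewrite mxE !ord1.
have WUh : invmx W *m basis_vec u h =
    col_mx (1%:M + z *: (b^T *m K *m evec R s))
      (col_mx (h *: (1%:M + z *: (b^T *m K *m c))) (K^T *m b)).
  rewrite Uh elim SU0E U0E scalemxAr -!mulmxDr mulKmx//.
  rewrite (@scale_col_mx _ 1 s.+1) (@scale_col_mx _ 1 s) !scaler0.
  rewrite !(@add_col_mx _ 1 s.+1) addr0 !add0r (@add_col_mx _ 1 s) add0r.
  by rewrite scalerDr scalerA.
have WSUh : invmx W *m (S *m basis_vec u h) =
    col_mx (h^-1 *: (z *: (d^T *m K *m evec R s)))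
      (col_mx (1%:M + z *: (d^T *m K *m c)) (h^-1 *: (K^T *m d))).
  (* The elimination is about h^2 N, whereas S U(h) contains h N. *)
  have -> : S *m basis_vec u h = S *m basis_vec u 0 +
      h^-1 *: (h ^+ 2 *:
        (\matrix_(i, j) (S *m S *m basis_vec u (c j 0 * h)) i 0 *m d)).
    by rewrite SUh scalerA expr2 mulKf.
  rewrite elim SU0E scalemxAr -!mulmxDr mulKmx//.
  rewrite (@scale_col_mx _ 1 s.+1) (@scale_col_mx _ 1 s).
  rewrite (@add_col_mx _ 1 s.+1) (@add_col_mx _ 1 s) !add0r.
  by rewrite !scalerA mulKf.
rewrite WUh WSUh !fst_coord !snd_coord !scalerA mulVf// mulfV//.
by rewrite !scale1r mul1r.
Qed.

(** * The stability matrix of the method *)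

(** The stages solve (I - z A) Y = y e + h y' c, so a step from any state exists
    and its result is determined. *)
Lemma unique_stability_matrix {R : realType} {s} (c : 'cV[R]_s) (A : 'M[R]_s)
    (b d : 'cV[R]_s) (lambda h : R) : h != 0 ->
  1%:M - (lambda * h ^+ 2) *: A \in unitmx ->
  unique (is_stability_matrix c A b d lambda h)
    (stability_matrix_coeffs c A b d (lambda * h ^+ 2)).
Proof.
move=> h0; set z := lambda * h ^+ 2 => Aunit.
set K := invmx (1%:M - z *: A).
have fE (t : R) (Y : 'cV[R]_s) :
    \col_(i < s) (fun _ x => lambda * x) (t + c i 0 * h) (Y i 0) = lambda *: Y.
  by apply/colP => i; rewrite !mxE.
have stageE (Y w : 'cV[R]_s) :
    Y = w + h ^+ 2 *: (A *m (lambda *: Y)) <-> Y = K *m w.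
  rewrite -scalemxAr scalerA [h ^+ 2 * _]mulrC -/z scalemxAl.
  split => [YE|->].
    by rewrite -[LHS](mulKmx Aunit) mulmxBl mul1mx {1}YE addrK.
  apply/eqP; rewrite -subr_eq; apply/eqP.
  by rewrite -{1}[K *m w]mul1mx -mulmxBl mulKVmx.
have coeffs_stab : is_stability_matrix c A b d lambda h
    (stability_matrix_coeffs c A b d z).
  move=> t y y' Y y1 y1' [/=].
  rewrite (fE t) => /stageE YE y1E y1'E.
  have stage_sumE (w : 'cV[R]_s) : h ^+ 2 * (w^T *m (lambda *: Y)) 0 0 =
      y * (z * (w^T *m K *m evec R s) 0 0) + h * y' * (z * (w^T *m K *m c) 0 0).
    rewrite YE -scalemxAr mulmxA mulmxDr -!scalemxAr.
    rewrite mxE [X in lambda * X]mxE [X in _ * (_ * (X + _))]mxE.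
    rewrite [X in _ * (_ * (_ + X))]mxE.
    by rewrite /z; ring.
  rewrite /state_vec /stability_matrix_coeffs -/K.
  rewrite [RHS](@mul_block_col _ 1 1 1 1 1).
  rewrite !mulmxDl !mul1mx !mul_mx_scalar.
  apply: (f_equal2 (@col_mx _ 1 1 1)); rewrite ?y1E ?y1'E.
    rewrite stage_sumE.
    move: (b^T *m K *m evec R s) (b^T *m K *m c) => be bc.
    by apply/matrixP => i j; rewrite !ord1 !mxE eqxx !mulr1n; exact: addrACA.
  rewrite mulrDr mulrA -expr2 stage_sumE.
  move: (d^T *m K *m evec R s) (d^T *m K *m c) => de dc.
  by apply/matrixP => i j; rewrite !ord1 !mxE eqxx !mulr1n; exact: addrCA.
split=> // M M_stab.
have step y y' : exists Y y1 y1',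
    FRKN_step c A b d h (fun _ x => lambda * x) 0 y y' Y y1 y1'.
  exists (K *m (y *: evec R s + (h * y') *: c)).
  do 2 eexists; split; [|reflexivity|reflexivity].
  by rewrite (fE 0); apply/stageE.
(* Every vector is a state vector, as h is nonzero. *)
have eqM (v : 'cV[R]_(1 + 1)) :
    stability_matrix_coeffs c A b d z *m v = M *m v.
  have -> : v = state_vec h (usubmx v 0 0) (h^-1 * dsubmx v 0 0).
    by rewrite /state_vec mulVKf// -!mx11_scalar vsubmxK.
  set y := usubmx v 0 0; set y' := _ * _.
  have [Y [y1 [y1' one_step]]] := step y y'.
  by rewrite -(M_stab _ _ _ _ _ _ one_step) -(coeffs_stab _ _ _ _ _ _ one_step).
apply/matrixP => i j; have := eqM (delta_mx j 0).
by rewrite -!colE => /colP/(_ i); rewrite !mxE.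
Qed.

Theorem theorem5p2 (R : realType) (s : nat)
  (c : 'cV[R]_s) (hc : injective (fun i : 'I_s => c i 0))
  (u : 'I_s -> R -> R) (hu : separable_basis u)
  (S : 'M[R]_s.+2)
  (hS : forall t : R, basis_vec u t = expmx (t *: S) *m basis_vec u 0)
  (A : R -> R -> 'M[R]_s) (b d : R -> R -> 'cV[R]_s)
  (hAbd : FRKN_coefficients u c A b d)
  (lambda h : R) (hh : 0 < h) (hcol : collocation_cond u c 0 h) :
  let u0 := basis_vec u 0 in
  let z := lambda * h ^+ 2 in
  1%:M - z *: A 0 h \in unitmx ->
  Wmx S u0 c z h \in unitmx ->
  unique (is_stability_matrix c (A 0 h) (b 0 h) (d 0 h) lambda h)
    (stability_matrix_coeffs c (A 0 h) (b 0 h) (d 0 h) z) /\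
  stability_matrix_coeffs c (A 0 h) (b 0 h) (d 0 h) z
    = stability_matrix_exp S u0 c z h.
Proof.
move=> u0 z Aunit Wunit.
have h0 : h != 0 by rewrite gt_eqF.
split; first exact: unique_stability_matrix.
exact: (stability_matrix_coeffs_exp _ _ _ _ _ _ _ _ h0 hS (hAbd 0 h hcol)).
Qed.
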